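(* Let $H$ and $X$ be linear operators on a complex Hilbert space $\mathscr{H}$ satisfying the following conditions. (C.1) $H$ is symmetric and $X$ is self-adjoint. (C.2) There exists $\delta_X>0$ such that for all $\Psi\in\mathscr{D}(X)$, $\delta_X(\Psi,\Psi)\le |(\Psi,X\Psi)|$. (C.3) $X$ has a core $\mathscr{D}_0$ satisfying $\mathscr{D}_0\subset\mathscr{D}(H)$, and there exist constants $a\ge 0$ and $b\ge 0$ such that for all $\Psi\in\mathscr{D}_0$, $\|H\Psi\|\le a\|X\Psi\|+b\|\Psi\|$. Suppose in addition that at least one of the following (I), (II) holds. (I) There exists a constant $d_1\ge 0$ such that for all $\Psi\in\mathscr{D}_0$, $$\left|(H\Psi,X\Psi)+(X\Psi,H\Psi)\right|\le d_1\,|(\Psi,X\Psi)|.$$ (II) There exists a constant $d_2>0$ such that for all $\Psi\in\mathscr{D}_0$, $$d_2\,|(\Psi,X\Psi)|\le \left|(H\Psi,X\Psi)+(X\Psi,H\Psi)\right|.$$ Then $H$ is essentially self-adjoint on $\mathscr{D}_0$.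
   Context: $\mathscr{D}(A)$ denotes the domain of a (possibly unbounded) linear operator $A$; $(\cdot,\cdot)$ and $\|\cdot\|$ are the inner product and norm of $\mathscr{H}$. A densely defined operator $H$ is symmetric if $H\subset H^*$, self-adjoint if $H=H^*$, and essentially self-adjoint if its closure $\overline{H}$ is self-adjoint. ''$H$ is essentially self-adjoint on $\mathscr{D}_0$'' means that the restriction of $H$ to $\mathscr{D}_0$ is essentially self-adjoint. A core of a self-adjoint operator $X$ is a subspace $\mathscr{D}_0\subset\mathscr{D}(X)$ such that the closure of the restriction of $X$ to $\mathscr{D}_0$ is $X$. *)

(* Defs.v *)
From HB Require Import structures.
From mathcomp Require Import all_boot all_order all_algebra.
From mathcomp Require Import sesquilinear complex.
From mathcomp Require Import all_classical all_reals all_analysis.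

Set Implicit Arguments.
Unset Strict Implicit.
Unset Printing Implicit Defensive.

Import Order.TTheory GRing.Theory Num.Theory.

Local Open Scope classical_set_scope.
Local Open Scope complex_scope.
Local Open Scope ring_scope.

(* The norm of a normed module over R[i] takes its values in R[i] and is
   nonnegative for the order of R[i], hence real.  Following [{dot _ for _}],
   the inner product is linear in its first argument and conjugate-linear in
   its second. *)
HB.mixin Record CompleteNormedModule_isHilbert (R : realType) V
    of CompleteNormedModule R[i] V := {
  inner : {dot V for (Num.conj : R[i] -> R[i])} ;
  sqr_norm_inner : forall u : V, `|u| ^+ 2 = inner u u
}.

#[short(type="hilbertType")]
HB.structure Definition Hilbert (R : realType) :=
  {V of CompleteNormedModule_isHilbert R V & CompleteNormedModule R[i] V}.

Notation "''[' u , v ]" := (inner u v) : ring_scope.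

Section Operators.
Context {R : realType} {V : hilbertType R}.

(* The values of [app] outside [dom] are irrelevant: two operators are the same
   operator when they have the same [operator_graph]. *)
Record operator := Operator {
  dom : submodClosed V ;
  app :> V -> V ;
  app_linear : forall c : R[i],
    {in dom &, forall u v, app (c *: u + v) = c *: app u + app v}
}.

Definition operator_graph (A : operator) : set (V * V) :=
  [set p | p.1 \in dom A /\ p.2 = A p.1].

Definition densely_defined (A : operator) := dense [set` dom A].

(* The graph of the adjoint: [(v, w)] belongs to it when [(A u, v) = (u, w)]
   for all [u] in the domain of [A].  This set is the graph of an operator
   exactly when [A] is densely defined. *)
Definition adjoint_graph (A : operator) : set (V * V) :=
  [set p | {in dom A, forall u, '[A u, p.1] = '[u, p.2]}].

Definition symmetric_operator (A : operator) :=
  densely_defined A /\ operator_graph A `<=` adjoint_graph A.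

Definition self_adjoint (A : operator) :=
  densely_defined A /\ operator_graph A = adjoint_graph A.

Definition is_closure_of (B A : operator) :=
  operator_graph B = closure (operator_graph A).

(* The existence of [B] says in particular that [A] is closable. *)
Definition essentially_self_adjoint (A : operator) :=
  densely_defined A /\ exists2 B, is_closure_of B A & self_adjoint B.

Section Restriction.
Variables (A : operator) (D : submodClosed V).
Hypothesis subD : {subset D <= dom A}.

Fact restrict_linear (c : R[i]) :
  {in D &, forall u v, A (c *: u + v) = c *: A u + A v}.
Proof. by move=> u v /subD uA /subD vA; apply: app_linear. Qed.

Definition restrict := Operator restrict_linear.
End Restriction.

Definition core (X : operator) (D : submodClosed V) :=
  exists subD : {subset D <= dom X}, is_closure_of X (restrict subD).

Definition essentially_self_adjoint_on (H : operator) (D : submodClosed V) :=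
  exists subD : {subset D <= dom H}, essentially_self_adjoint (restrict subD).

End Operators.

Arguments operator {R} V.

(* Main.v *)
Require Import Defs.
From HB Require Import structures.
From mathcomp Require Import all_boot all_order all_algebra.
From mathcomp Require Import sesquilinear complex.
From mathcomp Require Import all_classical all_reals all_analysis ring lra.

Set Implicit Arguments.
Unset Strict Implicit.
Unset Printing Implicit Defensive.

Import Order.TTheory GRing.Theory Num.Theory.

Local Open Scope classical_set_scope.
Local Open Scope complex_scope.
Local Open Scope ring_scope.

(** Write q(u) = (u, X u), a real number.  Either hypothesis on the
    anticommutator gives a real mu and a c > 0 with

      c |q(u)| <= |Re (H u, X u) - mu q(u)|      for u in D0:

    the anticommutator at u is 2 Re (H u, X u), so when d1 |q(u)| bounds it from
    above, mu = d1/2 + 1 pushes mu q(u) out of reach of Re (H u, X u), and when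
    d2 |q(u)| bounds it from below, mu = 0 works.
    The right-hand side is |Re ((H - z) u, X u)| for every z with real part
    mu, whatever its imaginary part; since delta |u|^2 <= |q(u)|, this becomes
    a lower bound c' |u|^2 <= |((H - z) u, X u)| on D0.

    Such a bound makes (H - z) D0 dense. The bound delta |u|^2 <= |q(u)|
    also makes X map its domain onto the whole space ([self_adjoint_onto]),
    so a vector orthogonal to (H - z) D0 has the form X u. Approximate u by
    u_n in the core with X u_n -> X u. Then ((H - z) u_n, X u_n) = ((H - z)
    u_n, X u_n - X u) tends to 0, because H is bounded relative to X, which
    keeps (H - z) u_n bounded; hence u_n -> 0 and u = 0
    ([dense_range_of_form_bound]).

    Taking z = mu + i and its conjugate, the restriction of H to D0 is a
    symmetric operator for which both ranges are dense, which is the classical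
    criterion for essential self-adjointness
    ([essentially_self_adjoint_of_dense_range]).

    Two facts about Hilbert spaces carry the functional analysis: a subspace
    with trivial orthogonal complement is dense ([dense_of_orthogonal]), and a
    closed operator that is bounded below and has dense range is onto
    ([closed_bounded_below_onto]).  Both get their limit point from the same
    form of completeness, [cantor_rnorm]. *)

(** * Real-valued norms *)

Section RealNorm.
Context {R : realType}.

(** The norm of a module over [R[i]] is a complex number that happens to be
    real; reading it in [R] makes the order total. *)
Definition rnorm {W : normedZmodType R[i]} (x : W) : R := complex.Re `|x|.

Lemma rnormE (W : normedZmodType R[i]) (x : W) : `|x| = (rnorm x)%:C.
Proof. by rewrite /rnorm RRe_real ?normr_real. Qed.

Lemma rnorm_ge0 (W : normedZmodType R[i]) (x : W) : 0 <= rnorm x.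
Proof. by rewrite -lecR -rnormE normr_ge0. Qed.

Lemma rnorm_eq0 (W : normedZmodType R[i]) (x : W) : (rnorm x == 0) = (x == 0).
Proof. by rewrite -(normr_eq0 x) rnormE -(inj_eq (@complexI R)). Qed.

Lemma rnorm0 (W : normedZmodType R[i]) : rnorm (0 : W) = 0.
Proof. by apply/eqP; rewrite rnorm_eq0. Qed.

Lemma ler_rnormD (W : normedZmodType R[i]) (x y : W) :
  rnorm (x + y) <= rnorm x + rnorm y.
Proof. by rewrite -lecR rmorphD /= -!rnormE ler_normD. Qed.

Lemma rnormB (W : normedZmodType R[i]) (x y : W) : rnorm (x - y) = rnorm (y - x).
Proof. by rewrite /rnorm distrC. Qed.

Lemma rnormN (W : normedZmodType R[i]) (x : W) : rnorm (- x) = rnorm x.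
Proof. by rewrite /rnorm normrN. Qed.

Lemma rnormZ (W : normedModType R[i]) (a : R[i]) (x : W) :
  rnorm (a *: x) = rnorm a * rnorm x.
Proof. by apply: complexI; rewrite rmorphM /= -!rnormE normrZ. Qed.

Lemma rnormC (a : R) : rnorm a%:C = `|a|.
Proof. by rewrite /rnorm normc_def /= expr0n /= addr0 sqrtr_sqr. Qed.

Lemma ler_Re_rnorm (z : R[i]) : `|complex.Re z| <= rnorm z.
Proof. by rewrite -lecR -rnormE normc_ge_Re. Qed.

Lemma ler_Im_rnorm (z : R[i]) : `|complex.Im z| <= rnorm z.
Proof.
rewrite /rnorm normc_def /= -sqrtr_sqr.
by rewrite ler_sqrt ?lerDr ?addr_ge0 ?sqr_ge0.
Qed.

End RealNorm.

(** * Closure and density in terms of the norm *)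

Section Topology.
Context {R : realType} {V : normedModType R[i]}.
Implicit Types (S : set V) (x y : V) (G : set (V * V)) (p : V * V).

Lemma closure_rnormP S x :
  closure S x <-> forall e : R, 0 < e -> exists2 y, S y & rnorm (x - y) < e.
Proof.
split=> [clS e e0|h].
  have [y [Sy]] : S `&` ball x e%:C !=set0.
    by apply: clS; apply: nbhsx_ballx; rewrite ltcR.
  by rewrite -ball_normE /= rnormE ltcR; exists y.
move=> B /nbhs_ballP[e /= e0 eB].
have eE : e = (complex.Re e)%:C by rewrite RRe_real // gtr0_real.
have [|y Sy xy] := h (complex.Re e); first by rewrite -ltcR -eE.
exists y; split => //; apply: eB.
by rewrite -ball_normE /= rnormE eE ltcR.
Qed.

Lemma closure_prod_rnormP G p : closure G p <-> forall e : R, 0 < e ->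
  exists2 q, G q & rnorm (p.1 - q.1) < e /\ rnorm (p.2 - q.2) < e.
Proof.
split=> [clS e e0|h].
  have [y [Sy]] : G `&` ball p e%:C !=set0.
    by apply: clS; apply: nbhsx_ballx; rewrite ltcR.
  by case; rewrite -!ball_normE /= !rnormE !ltcR; exists y.
move=> B /nbhs_ballP[e /= e0 eB].
have eE : e = (complex.Re e)%:C by rewrite RRe_real // gtr0_real.
have [|y Sy [xy1 xy2]] := h (complex.Re e); first by rewrite -ltcR -eE.
exists y; split => //; apply: eB; split;
by rewrite -ball_normE /= rnormE eE ltcR.
Qed.

Lemma dense_rnormP S :
  dense S <-> forall x (e : R), 0 < e -> exists2 y, S y & rnorm (x - y) < e.
Proof.
split=> [dS x|h O [x Ox] oO].
  apply/closure_rnormP => B /nbhs_ballP[e /= e0 eB].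
  have [|y [/interior_subset yB Sy]] := dS (ball x e)^°%classic _ (open_interior _).
    by exists x; apply: nbhsx_ballx.
  by exists y; split => //; apply: eB.
have [y [Sy Oy]] : S `&` O !=set0.
  by move: (h x) => /closure_rnormP; apply; apply: open_nbhs_nbhs.
by exists y.
Qed.

End Topology.

(** * Completeness *)

Section Cantor.
Context {R : realType} {V : completeNormedModType R[i]}.

(** The sets [A e] generate a Cauchy filter.  Its limit need not belong to any of
    the sets, which are not assumed closed, but it is approached by points of
    each of them: this is the form in which approximate minimizers, or
    approximate solutions of an equation, yield a limit. *)
Lemma cantor_rnorm (A : R -> set V) :
  (forall e : R, 0 < e -> A e !=set0) ->
  (forall e e' : R, 0 < e -> e <= e' -> A e `<=` A e') ->
  (forall r : R, 0 < r -> exists2 e : R, 0 < e &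
    forall u v, A e u -> A e v -> rnorm (u - v) < r) ->
  exists p, forall e : R, 0 < e -> exists2 u, A e u & rnorm (p - u) < e.
Proof.
move=> A0 Amono Adiam.
set F := filter_from [set e : R | 0 < e] A.
have FF : ProperFilter F.
  apply: filter_from_proper => //.
  apply: filter_from_filter; first by exists 1; rewrite /= ltr01.
  move=> i j /= i0 j0; have m0 : 0 < Num.min i j by rewrite lt_min i0.
  exists (Num.min i j) => // u Au.
  by split; apply: Amono Au; rewrite // ge_min lexx ?orbT.
have /cauchy_cvg cF : cauchy F.
  apply: cauchy_exP => r r0.
  have rE : r = (complex.Re r)%:C by rewrite RRe_real // gtr0_real.
  have [|e e0 he] := Adiam (complex.Re r); first by rewrite -ltcR -rE.
  have [u Au] := A0 e e0.
  exists u, e => // v Av.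
  by rewrite -ball_normE /= rnormE rE ltcR he.
exists (lim F) => e e0.
have : F (ball (lim F) e%:C) by apply: cF; apply: nbhsx_ballx; rewrite ltcR.
case=> e' /= e'0 sub.
have m0 : 0 < Num.min e e' by rewrite lt_min e0.
have [u Au] := A0 _ m0.
exists u; first by apply: Amono Au; rewrite // ge_min lexx.
have : A e' u by apply: Amono Au; rewrite // ge_min lexx orbT.
by move=> /sub; rewrite -ball_normE /= rnormE ltcR.
Qed.

End Cantor.

(** * Inner product *)

Section Inner.
Context {R : realType} {V : hilbertType R}.
Implicit Types (u v w : V).

Lemma innerZl (a : R[i]) u v : '[a *: u, v] = a * '[u, v].
Proof. by rewrite linearZl_LR. Qed.

Lemma innerZr (a : R[i]) u v : '[u, a *: v] = Num.conj a * '[u, v].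
Proof. by rewrite linearZr_LR. Qed.

Lemma innerDl u v w : '[u + v, w] = '[u, w] + '[v, w].
Proof. exact: linearDl. Qed.

Lemma innerDr u v w : '[w, u + v] = '[w, u] + '[w, v].
Proof. exact: linearDr. Qed.

Lemma innerBl u v w : '[u - v, w] = '[u, w] - '[v, w].
Proof. exact: linearBl. Qed.

Lemma innerBr u v w : '[w, u - v] = '[w, u] - '[w, v].
Proof. exact: linearBr. Qed.

Lemma inner_conj u v : '[u, v] = Num.conj '[v, u].
Proof. by rewrite hermC /= expr0 mul1r. Qed.

Lemma inner_self u : '[u, u] = (rnorm u ^+ 2)%:C.
Proof. by rewrite -sqr_norm_inner rnormE rmorphXn. Qed.

(** Subtracting from [u] its projection on the line of [v] lowers the squared
    norm by |(u, v)|^2 / |v|^2.  A lower bound on the distance from [u] to that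
    line thus bounds (u, v): with the bound 0 this is the Cauchy-Schwarz
    inequality, with the distance to a subspace it is the near orthogonality of
    near minimizers used in [dense_of_orthogonal]. *)
Lemma inner_projection u v : v != 0 -> exists t : R[i],
  rnorm '[u, v] ^+ 2 = (rnorm u ^+ 2 - rnorm (u - t *: v) ^+ 2) * rnorm v ^+ 2.
Proof.
move=> v0.
have nv0 : '[v, v] != 0.
  by rewrite inner_self (inj_eq (@complexI R)) sqrf_eq0 rnorm_eq0.
exists ('[u, v] / '[v, v]).
apply: complexI.
rewrite [RHS]rmorphM [X in X * _]rmorphB /= -!inner_self rmorphXn /= -rnormE normCK.
have tC : Num.conj ('[u, v] / '[v, v]) = '[v, u] / '[v, v].
  by rewrite rmorphM fmorphV; congr (_ * _^-1); exact: esym (inner_conj _ _).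
rewrite innerBl !innerBr !innerZr !innerZl tC -inner_conj.
by field.
Qed.

Lemma cauchy_schwarz u v : rnorm '[u, v] <= rnorm u * rnorm v.
Proof.
have [->|/(inner_projection u)[t h]] := eqVneq v 0.
  by rewrite linear0r !rnorm0 mulr0.
rewrite -(@ler_pXn2r _ 2) ?nnegrE ?mulr_ge0 ?rnorm_ge0 // h exprMn.
by rewrite ler_wpM2r ?sqr_ge0 // gerBl sqr_ge0.
Qed.

Lemma parallelogram u v :
  rnorm (u + v) ^+ 2 + rnorm (u - v) ^+ 2 = 2 * (rnorm u ^+ 2 + rnorm v ^+ 2).
Proof.
apply: complexI; rewrite rmorphM !rmorphD /= -!inner_self.
rewrite innerBl innerDl !innerBr !innerDr.
by ring.
Qed.

End Inner.

(** * Orthogonality and density *)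

Section Projection.
Context {R : realType} {V : hilbertType R}.
Implicit Types (u v w : V) (M S : set V).

Lemma le0_of_small (x C : R) :
  (forall e : R, 0 < e -> e <= 1 -> x <= C * e) -> x <= 0.
Proof.
move=> h; rewrite leNgt; apply/negP => x0.
pose K := `|C| + 1 + x.
have K0 : 0 < K by rewrite /K; have := normr_ge0 C; lra.
have e0 : 0 < x / (2 * K) by rewrite divr_gt0 // mulr_gt0.
have e1 : x / (2 * K) <= 1.
  by rewrite ler_pdivrMr ?mulr_gt0 // mul1r /K; have := normr_ge0 C; lra.
have := h _ e0 e1.
have CK : C <= K by rewrite /K; have := ler_norm C; lra.
have : C * (x / (2 * K)) <= K * (x / (2 * K)) by rewrite ler_wpM2r // ltW.
have -> : K * (x / (2 * K)) = x / 2 by field; rewrite gt_eqF.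
lra.
Qed.

Lemma dense_orthogonal_eq0 S v :
  dense S -> (forall u, S u -> '[u, v] = 0) -> v = 0.
Proof.
move=> /dense_rnormP dS ortho.
suff : rnorm v ^+ 2 <= 0.
  by rewrite exprn_even_le0 //= rnorm_eq0 => /eqP.
apply: (@le0_of_small _ (rnorm v)) => e e0 _.
have [u Su uv] := dS v e e0.
rewrite -[X in X <= _]ger0_norm ?sqr_ge0 // -rnormC -inner_self.
have -> : '[v, v] = '[v - u, v] by rewrite innerBl (ortho u Su) subr0.
rewrite (le_trans (cauchy_schwarz _ _)) // mulrC.
by rewrite ler_wpM2l ?rnorm_ge0 // ltW.
Qed.

(** Points of [M] that nearly minimize the distance to [w] are close to one another
    by the parallelogram identity, so they accumulate at some [p] in the closure
    of [M].  They are nearly orthogonal to [M] as seen from [w], so [w - p] is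
    orthogonal to [M], hence zero. *)
Lemma dense_of_orthogonal M :
  M 0 -> (forall a u v, M u -> M v -> M (a *: u + v)) ->
  (forall v, (forall u, M u -> '[u, v] = 0) -> v = 0) -> dense M.
Proof.
move=> M0 Mlin ortho; apply/dense_rnormP => w e e0.
pose E : set R := [set rnorm (w - m) ^+ 2 | m in M].
have Einf : has_inf E.
  split; first by exists (rnorm (w - 0) ^+ 2), 0.
  by exists 0 => _ [m _ <-]; rewrite sqr_ge0.
pose d := inf E.
have d_le m : M m -> d <= rnorm (w - m) ^+ 2.
  by move=> Mm; apply: ge_inf; [case: Einf|exists m].
pose A r := [set m | M m /\ rnorm (w - m) ^+ 2 < d + r].
have [|||p hp] := @cantor_rnorm R V A.
- move=> r r0; have [_ [m Mm <-] mr] := inf_adherent r0 Einf.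
  by exists m.
- move=> r r' r0 rr' m [Mm mr]; split => //.
  by rewrite (lt_le_trans mr) // lerD2l.
- move=> r r0; exists (r ^+ 2 / 4); first by rewrite divr_gt0 ?exprn_gt0.
  move=> u v [Mu ur] [Mv vr].
  (* The midpoint of u and v is in M, hence at squared distance at least d. *)
  have Muv : M (2^-1 *: (1 *: u + v)).
    by rewrite -[X in M X]addr0; do 2?apply: (Mlin) => //.
  have := parallelogram (w - u) (w - v).
  have -> : w - u + (w - v) = 2 *: (w - 2^-1 *: (1 *: u + v)).
    rewrite scale1r scalerBr scalerA divff ?pnatr_eq0 // scale1r.
    by rewrite scaler_nat mulr2n opprD addrACA.
  have -> : w - u - (w - v) = v - u by rewrite opprB addrC addrA subrK.
  have n2 : rnorm (2 : R[i]) = 2.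
    by have := rnormC (2 : R); rewrite rmorph_nat => ->; rewrite ger0_norm.
  rewrite rnormZ n2 (rnormB v u) exprMn => eqn.
  have := d_le _ Muv => dm.
  rewrite -(@ltr_pXn2r _ 2) ?nnegrE ?rnorm_ge0 ?(ltW r0) //.
  by move: eqn dm ur vr; lra.
suff wp : w - p = 0.
  have [u [Mu _] pu] := hp _ e0.
  by exists u => //; rewrite (subr0_eq wp).
apply: ortho => m Mm; rewrite inner_conj.
suff : rnorm '[w - p, m] <= 0.
  rewrite le_eqVlt ltNge rnorm_ge0 orbF rnorm_eq0 => /eqP ->.
  by rewrite rmorph0.
apply: (@le0_of_small _ (2 * rnorm m)) => r r0 r1.
have r20 : 0 < r ^+ 2 by rewrite exprn_gt0.
have [u [Mu ur] pu] := hp _ r20.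
(* Moving u along m inside M gains at most r ^+ 2 over the infimum d. *)
have um : rnorm '[w - u, m] <= r * rnorm m.
  have [->|/(inner_projection (w - u))[t ht]] := eqVneq m 0.
    by rewrite linear0r !rnorm0 mulr0.
  rewrite -(@ler_pXn2r _ 2) ?nnegrE ?mulr_ge0 ?rnorm_ge0 ?(ltW r0) // ht exprMn.
    rewrite ler_wpM2r ?sqr_ge0 //.
  have := d_le (t *: m + u) (Mlin _ _ _ Mm Mu).
  rewrite [t *: m + u]addrC opprD addrA; lra.
have -> : w - p = (w - u) + (u - p) by rewrite addrA subrK.
rewrite innerDl (le_trans (ler_rnormD _ _)) //.
have : rnorm '[u - p, m] <= r * rnorm m.
  rewrite (le_trans (cauchy_schwarz _ _)) // ler_wpM2r ?rnorm_ge0 //.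
  by rewrite rnormB (le_trans (ltW pu)) // expr2 ler_piMr // ltW.
lra.
Qed.

End Projection.

(** * Closed operators *)

Section OperatorTheory.
Context {R : realType} {V : hilbertType R}.
Implicit Types (u v w : V) (A B X : operator V) (G : set (V * V)) (z : R[i]).

Definition shifted_range A z : set V :=
  [set A u - z *: u | u in [set` dom A]].

Lemma app0 A : A 0 = 0.
Proof.
have := app_linear (-1) (rpred0 (dom A)) (rpred0 (dom A)).
by rewrite scaler0 addr0 scaleN1r addNr.
Qed.

Lemma shifted_range_lin A z a u v :
  shifted_range A z u -> shifted_range A z v -> shifted_range A z (a *: u + v).
Proof.
move=> [x Dx <-] [y Dy <-]; exists (a *: x + y).
  by rewrite /= rpredD // rpredZ.
rewrite app_linear // !scalerBr !scalerDr !opprD !scalerA (mulrC z a).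
by rewrite addrACA.
Qed.

(** Approximate solutions of B u - z u = w exist because the range is dense, and
    form a Cauchy family because B - z is bounded below; the graph being closed,
    their limit is a solution. *)
Lemma closed_bounded_below_onto B z (c : R) :
  is_closure_of B B -> 0 < c ->
  {in dom B, forall u, c * rnorm u <= rnorm (B u - z *: u)} ->
  dense (shifted_range B z) ->
  forall w, exists2 u, u \in dom B & B u - z *: u = w.
Proof.
move=> clB c0 below /dense_rnormP dB w.
pose A e := [set u | u \in dom B /\ rnorm (w - (B u - z *: u)) < e].
have [|||p hp] := @cantor_rnorm R V A.
- by move=> e /(dB w)[_ [u Du <-]]; exists u.
- by move=> e e' _ ee' u [Du h]; split => //; exact: lt_le_trans h ee'.
- move=> r r0; exists (c * r / 2); first by rewrite divr_gt0 ?mulr_gt0.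
  move=> u v [Du ue] [Dv ve].
  have Bm : (B (u - v) - z *: (u - v)) =
     (w - (B v - z *: v)) - (w - (B u - z *: u)).
    have -> : B (u - v) = B u - B v.
      have := app_linear (-1) Dv Du.
      by rewrite !scaleN1r addrC => ->; rewrite addrC.
    have -> x y : w - x - (w - y) = y - x by rewrite opprB addrC addrA subrK.
    by rewrite scalerBr !opprB (addrC (z *: v)) addrACA (addrC (- B v)).
  have Duv : u - v \in dom B by rewrite -scaleN1r rpredD // rpredZ.
  have := below _ Duv; rewrite Bm => h.
  have := ler_rnormD (w - (B v - z *: v)) (- (w - (B u - z *: u))).
  rewrite rnormN => h2.
  by rewrite -(ltr_pM2l c0); lra.
have : operator_graph B (p, w + z *: p).
  rewrite clB; apply/closure_prod_rnormP => e e0 /=.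
  pose K := 1 + rnorm z.
  have K0 : 0 < K by rewrite /K ltr_pwDl ?rnorm_ge0.
  have K1 : 1 <= K by rewrite /K lerDl rnorm_ge0.
  have [|u [Du uw] pu] := hp (e / K); first by rewrite divr_gt0.
  have eK : e / K <= e by rewrite ler_pdivrMr // ler_peMr // ltW.
  exists (u, B u); first by [].
  split => /=; first exact: lt_le_trans pu eK.
  have -> : w + z *: p - B u = (w - (B u - z *: u)) + z *: (p - u).
    rewrite opprB scalerBr -addrA -[RHS]addrA; congr (w + _).
    by rewrite [RHS]addrC addrA subrK.
  rewrite (le_lt_trans (ler_rnormD _ _)) // rnormZ.
  have : rnorm z * rnorm (p - u) <= rnorm z * (e / K).
    by rewrite ler_wpM2l ?rnorm_ge0 // ltW.
  have : e = e / K + rnorm z * (e / K).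
    by rewrite -{1}(divfK (lt0r_neq0 K0) e) /K; ring.
  lra.
move=> [/= Dp Bp]; exists p => //.
by rewrite -Bp addrK.
Qed.

(** For fixed [p] the relation (q.2, p.1) = (q.1, p.2) is closed in [q], so a pair
    is in the adjoint of a graph as soon as it is in the adjoint of a part of it
    that is dense. *)
Lemma adjoint_closure G p :
  (forall q, G q -> '[q.2, p.1] = '[q.1, p.2]) ->
  forall q, closure G q -> '[q.2, p.1] = '[q.1, p.2].
Proof.
move=> GP q /closure_prod_rnormP clq; apply/eqP; rewrite -subr_eq0 -rnorm_eq0.
rewrite eq_le rnorm_ge0 andbT.
apply: (@le0_of_small _ _ (rnorm p.1 + rnorm p.2)) => e e0 _.
have [g Gg [g1 g2]] := clq _ e0.
have -> : '[q.2, p.1] - '[q.1, p.2] = '[q.2 - g.2, p.1] - '[q.1 - g.1, p.2].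
  by rewrite !innerBl (GP g Gg) opprB addrA subrK.
rewrite (le_trans (ler_rnormD _ _)) // rnormN mulrDl.
by apply: lerD; rewrite (le_trans (cauchy_schwarz _ _)) // mulrC;
  rewrite ler_wpM2l ?rnorm_ge0 // ltW.
Qed.

Lemma closure_graph_lin A (a : R[i]) p q :
  closure (operator_graph A) p -> closure (operator_graph A) q ->
  closure (operator_graph A) (a *: p.1 + q.1, a *: p.2 + q.2).
Proof.
move=> /closure_prod_rnormP clp /closure_prod_rnormP clq.
apply/closure_prod_rnormP => e e0.
pose K := rnorm a + 1.
have K0 : 0 < K by rewrite /K ltr_wpDl ?rnorm_ge0.
have d0 : 0 < e / K by rewrite divr_gt0.
have [p' [Dp' p'E] [pp1 pp2]] := clp _ d0.
have [q' [Dq' q'E] [qq1 qq2]] := clq _ d0.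
have step (x x' y y' : V) : rnorm (x - x') < e / K -> rnorm (y - y') < e / K ->
    rnorm (a *: x + y - (a *: x' + y')) < e.
  move=> xx yy; rewrite opprD addrACA -scalerBr.
  rewrite (le_lt_trans (ler_rnormD _ _)) // rnormZ.
  have : rnorm a * rnorm (x - x') <= rnorm a * (e / K).
    by rewrite ler_wpM2l ?rnorm_ge0 // ltW.
  have : e = rnorm a * (e / K) + e / K.
    by rewrite -{1}(divfK (lt0r_neq0 K0) e) /K; ring.
  lra.
exists (a *: p'.1 + q'.1, a *: p'.2 + q'.2); last by split; exact: step.
split => /=; first by rewrite rpredD // rpredZ.
by rewrite app_linear // p'E q'E.
Qed.

(** * The closure of a symmetric operator *)

Definition closure_dom A : V -> bool :=
  fun u => `[< exists w, closure (operator_graph A) (u, w) >].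

Fact closure_dom_submod A : GRing.subsemimod_closed (closure_dom A).
Proof.
have cl0 : closure (operator_graph A) (0, 0).
  by apply: subset_closure; split; rewrite /= ?rpred0 ?app0.
split; first split.
- by apply/asboolP; exists 0.
- move=> u v /asboolP[u' uu'] /asboolP[v' vv']; apply/asboolP.
  exists (1 *: u' + v'); rewrite -[u]scale1r.
  exact: closure_graph_lin uu' vv'.
- move=> a u /asboolP[u' uu']; apply/asboolP; exists (a *: u' + 0).
  by rewrite -[a *: u]addr0; exact: closure_graph_lin uu' cl0.
Qed.

HB.instance Definition _ A :=
  GRing.isSubmodClosed.Build _ V (closure_dom A) (closure_dom_submod A).

(** The closure of a graph that is single-valued is again the graph of an operator,
    whose values are picked by choice. *)
Lemma closable_closure A :
  (forall u v w, closure (operator_graph A) (u, v) ->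
     closure (operator_graph A) (u, w) -> v = w) ->
  exists B, is_closure_of B A.
Proof.
move=> fct.
pose f u : V := xget 0 [set w | closure (operator_graph A) (u, w)].
have fP u : u \in closure_dom A -> closure (operator_graph A) (u, f u).
  move=> /asboolP[w uw].
  exact: (@xgetPex V 0 [set w | closure (operator_graph A) (u, w)]
            (ex_intro _ w uw)).
have flin (c : R[i]) : {in closure_dom A &, forall u v,
    f (c *: u + v) = c *: f u + f v}.
  move=> u v /fP uf /fP vf.
  have cuv := closure_graph_lin (a := c) uf vf.
  apply: (fct (c *: u + v)) (cuv); apply: fP.
  by apply/asboolP; exists (c *: f u + f v); exact: cuv.
exists (@Operator R V
  (GRing.SubmodClosed.clone _ V (closure_dom A) _) f flin).
apply/seteqP; split=> [[u w] [/= Du ->]|[u w] uw]; first exact: fP.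
have Du : u \in closure_dom A by apply/asboolP; exists w.
by split => //=; apply: fct uw (fP _ Du).
Qed.

(** The closure of the graph is contained in the adjoint graph, which is
    single-valued because the domain is dense; closing up the other argument as
    well shows that the closure is symmetric. *)
Lemma symmetric_closure A : symmetric_operator A ->
  exists B, is_closure_of B A /\ symmetric_operator B.
Proof.
move=> [dA symA].
(* Adjointness is symmetric in the two pairs up to conjugation. *)
have half p : closure (operator_graph A) p ->
    {in dom A, forall u, '[A u, p.1] = '[u, p.2]}.
  move=> clp u Du; rewrite inner_conj [RHS]inner_conj; congr Num.conj.
  apply/esym; apply: (@adjoint_closure (operator_graph A) (u, A u)) clp.
  move=> q /symA qE /=; rewrite inner_conj [RHS]inner_conj; congr Num.conj.
  by rewrite qE.
have [|B BA] := @closable_closure A.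
  move=> u v w /half uv /half uw; apply/eqP; rewrite -subr_eq0; apply/eqP.
  apply: (dense_orthogonal_eq0 dA) => x Dx.
  by rewrite innerBr -(uv _ Dx) -(uw _ Dx) subrr.
exists B; split => //; split.
  apply/dense_rnormP => x e e0; move/dense_rnormP: dA => /(_ x e e0)[y Dy xy].
  exists y => //.
  have : operator_graph B (y, A y) by rewrite BA; apply: subset_closure.
  by case.
move=> p; rewrite BA => /half pA u Du.
have : operator_graph B (u, B u) by [].
by rewrite BA => /(@adjoint_closure _ p); apply => q [Dq ->]; exact: pA.
Qed.

Lemma symmetric_inner_real A u :
  symmetric_operator A -> u \in dom A -> complex.Im '[A u, u] = 0.
Proof.
move=> [_ sA] Du; have := sA (u, A u) (conj Du erefl) u Du => /= E.
have /complex_realP[k ->] : '[A u, u] \is Num.real.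
  by apply/CrealP; rewrite [in LHS]E; exact: esym (inner_conj _ _).
by [].
Qed.

(** * Self-adjointness from the range *)

(** As (A u, u) is real, the imaginary part of ((A - z) u, u) is -(Im z) |u|^2. *)
Lemma symmetric_shift_bound A z u : symmetric_operator A -> u \in dom A ->
  `|complex.Im z| * rnorm u <= rnorm (A u - z *: u).
Proof.
move=> sA Du; have [->|u0] := eqVneq u 0.
  by rewrite rnorm0 mulr0 rnorm_ge0.
have nu : 0 < rnorm u by rewrite lt_def rnorm_eq0 u0 rnorm_ge0.
rewrite -(ler_pM2r nu) (le_trans _ (cauchy_schwarz _ _)) //.
rewrite (le_trans _ (ler_Im_rnorm _)) // innerBl innerZl inner_self.
have := symmetric_inner_real sA Du.
case: '[A u, u] => a b /= ->; case: z => x y /=.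
rewrite mulr0 !add0r normrN normrM (ger0_norm (sqr_ge0 (rnorm u))).
by rewrite -mulrA -expr2.
Qed.

(** Let B be the closure of A.  Density of the range of A - z makes B - z onto.
    For (v, w) in the adjoint graph, solve B u - z u = w - z v: then v - u is
    orthogonal to the range of A - conj z, which is dense, so v = u lies in the
    domain of B. *)
Lemma essentially_self_adjoint_of_dense_range A z :
  symmetric_operator A -> complex.Im z != 0 ->
  dense (shifted_range A z) -> dense (shifted_range A (Num.conj z)) ->
  essentially_self_adjoint A.
Proof.
move=> sA z0 dz dzc; split; first by case: sA.
have [B [BA sB]] := symmetric_closure sA; exists B => //.
have sub p : operator_graph A p -> operator_graph B p.
  by rewrite BA; exact: subset_closure.
have clB : is_closure_of B B.
  by rewrite /is_closure_of BA; apply/closure_id; exact: closed_closure.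
have dB : dense (shifted_range B z).
  move=> O O0 oO; have [x [Ox [u Du uE]]] := dz O O0 oO.
  have [/= DBu AB] := sub (u, A u) (conj Du erefl).
  by exists x; split => //; exists u; rewrite // -AB.
have onto := closed_bounded_below_onto clB _ _ dB.
have {}onto w : exists2 u, u \in dom B & B u - z *: u = w.
  apply: (onto `|complex.Im z|); first by rewrite normr_gt0.
  by move=> u Du; exact: symmetric_shift_bound.
split; first by case: sB.
apply/seteqP; split; first by case: sB.
move=> [v w] adj.
have [u Du uE] := onto (w - z *: v).
suff vu : v = u.
  split => /=; first by rewrite vu.
  by move: uE; rewrite vu => /(addIr _).
apply/eqP; rewrite -subr_eq0; apply/eqP.
apply: (dense_orthogonal_eq0 dzc) => _ [a Da <-].
have [/= DBa AB] := sub (a, A a) (conj Da erefl).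
have aw : '[B a, v] = '[a, w] by exact: adj.
have au : '[B a, u] = '[a, B u] by case: sB => _ /(_ (u, B u)); apply.
have wE : w - B u = z *: (v - u).
  have {1}-> : w = B u - z *: u + z *: v by rewrite uE subrK.
  by rewrite scalerBr addrAC [B u - _]addrC addrK addrC.
rewrite AB innerBl innerZl !innerBr aw au -!innerBr wE innerZr.
by rewrite subrr.
Qed.

(** The form bound makes X bounded below, and a vector orthogonal to its range is in
    the kernel of the adjoint, which is X itself, hence is zero. *)
Lemma self_adjoint_onto X (c : R) : self_adjoint X -> 0 < c ->
  {in dom X, forall u, c * rnorm u ^+ 2 <= rnorm '[u, X u]} ->
  forall w, exists2 u, u \in dom X & X u = w.
Proof.
move=> [dX saX] c0 below.
have clX : is_closure_of X X.
  apply/seteqP; split; first exact: subset_closure.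
  move=> p clp; rewrite saX => u Du /=.
  have h : operator_graph X (u, X u) by [].
  rewrite inner_conj [RHS]inner_conj; congr Num.conj.
  apply/esym; apply: (@adjoint_closure (operator_graph X) (u, X u)) clp.
  move=> q; rewrite saX => /(_ u Du) /= qE.
  by rewrite inner_conj [RHS]inner_conj; congr Num.conj.
have bd : {in dom X, forall u, c * rnorm u <= rnorm (X u - 0 *: u)}.
  move=> u Du; rewrite scale0r subr0.
  have [->|u0] := eqVneq u 0; first by rewrite rnorm0 mulr0 rnorm_ge0.
  have nu : 0 < rnorm u by rewrite lt_def rnorm_eq0 u0 rnorm_ge0.
  rewrite -(ler_pM2l nu) (le_trans _ (cauchy_schwarz _ _)) //.
  by rewrite mulrCA -expr2 below.
suff dr : dense (shifted_range X 0).
  move=> w; have [u Du <-] := closed_bounded_below_onto clX c0 bd dr w.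
  by exists u => //; rewrite scale0r subr0.
apply: dense_of_orthogonal => [||v ortho].
- by exists 0; rewrite /= ?rpred0 // app0 scaler0 subr0.
- by move=> a u v; exact: shifted_range_lin.
have : operator_graph X (v, 0).
  rewrite saX => u Du /=; rewrite linear0r; apply: ortho.
  by exists u; rewrite // scale0r subr0.
case=> /= Dv v0; have := below v Dv; rewrite -v0 linear0r rnorm0.
by rewrite pmulr_rle0 // exprn_even_le0 //= rnorm_eq0 => /eqP.
Qed.

(** * Ranges on a core *)

Lemma core_dense X (D : submodClosed V) (subD : {subset D <= dom X}) :
  densely_defined X -> is_closure_of X (Defs.restrict subD) -> dense [set` D].
Proof.
move=> /dense_rnormP dX coreD; apply/dense_rnormP => x e e0.
have e20 : 0 < e / 2 by rewrite divr_gt0.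
have [y Dy xy] := dX x _ e20.
have : operator_graph X (y, X y) by [].
rewrite coreD => /closure_prod_rnormP /(_ _ e20)[[u _] [/= Du _] [yu _]].
exists u => //; have := ler_rnormD (x - y) (y - u); rewrite addrA subrK; lra.
Qed.

(** A vector orthogonal to the range of A - z is X u0 for some u0.  For u in the
    core with (u, X u) close to (u0, X u0), the form ((A - z) u, X u) does not
    change when X u0 is subtracted from X u, so it is small; the lower bound then
    forces u, and thus u0, to vanish. *)
Lemma dense_range_of_form_bound A X z (k c : R)
    (subA : {subset dom A <= dom X}) :
  is_closure_of X (Defs.restrict subA) ->
  (forall w, exists2 u, u \in dom X & X u = w) ->
  0 <= k -> 0 < c ->
  {in dom A, forall u, rnorm (A u - z *: u) <= k * (rnorm (X u) + rnorm u)} ->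
  {in dom A, forall u, c * rnorm u ^+ 2 <= rnorm '[A u - z *: u, X u]} ->
  dense (shifted_range A z).
Proof.
move=> coreA onto k0 c0 Abd form.
apply: dense_of_orthogonal => [||v ortho].
- by exists 0; rewrite /= ?rpred0 // app0 scaler0 subr0.
- by move=> a u v; exact: shifted_range_lin.
have [u0 Du0 u0E] := onto v.
suff u00 : u0 = 0 by rewrite -u0E u00 app0.
have : operator_graph X (u0, X u0) by [].
rewrite coreA => /closure_prod_rnormP approx.
suff : rnorm u0 ^+ 2 <= 0 by rewrite exprn_even_le0 //= rnorm_eq0 => /eqP.
pose K := k * (rnorm (X u0) + rnorm u0 + 2).
(* |u|^2 <= K e / c and |u0| <= |u| + e give |u0|^2 <= 2 (K e / c) + 2 e^2. *)
apply: (@le0_of_small _ _ (2 * (c^-1 * K) + 2)) => e e0 e1.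
have [[u _] [/= Du ->] [uu XX]] := approx e e0.
have nu : rnorm u <= rnorm u0 + 1.
  have := ler_rnormD u0 (u - u0); rewrite addrC subrK rnormB; lra.
have nX : rnorm (X u) <= rnorm (X u0) + 1.
  have := ler_rnormD (X u0) (X u - X u0); rewrite addrC subrK rnormB; lra.
have u2 : rnorm u ^+ 2 <= c^-1 * K * e.
  rewrite -mulrA -ler_pdivrMl ?invr_gt0 // invrK.
  rewrite (le_trans (form u Du)) //.
  have -> : '[A u - z *: u, X u] = '[A u - z *: u, X u - X u0].
    rewrite [RHS]innerBr u0E [X in _ = _ - X]ortho ?subr0 //.
    by exists u.
  rewrite (le_trans (cauchy_schwarz _ _)) //.
  apply: ler_pM; rewrite ?rnorm_ge0 //; last by rewrite rnormB ltW.
  rewrite (le_trans (Abd u Du)) // /K ler_wpM2l //; lra.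
have : rnorm u0 <= rnorm u + e.
  have := ler_rnormD u (u0 - u); rewrite addrC subrK; lra.
move=> u0e; apply: (@le_trans _ _ ((rnorm u + e) ^+ 2)).
  by rewrite ler_pXn2r ?nnegrE ?addr_ge0 ?rnorm_ge0 // ltW.
have sq : 0 <= (rnorm u - e) ^+ 2 by rewrite sqr_ge0.
have ee : e ^+ 2 <= e by rewrite expr2 ler_piMr // ltW.
lra.
Qed.

(** * The anticommutator *)

Lemma anticommutator_rnorm u v :
  rnorm ('[u, v] + '[v, u]) = 2 * `|complex.Re '[u, v]|.
Proof.
rewrite (inner_conj v u); case: '[u, v] => a b.
have -> : Complex a b + Num.conj (Complex a b) = (2 * a)%:C.
  by apply/eqP; rewrite eq_complex /= subrr eqxx andbT mulr_natl mulr2n.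
by rewrite rnormC normrM ger0_norm.
Qed.

End OperatorTheory.

Theorem theorem1 (R : realType) (V : hilbertType R) (H X : operator V)
    (D0 : submodClosed V) :
  (* (C.1) *)
  symmetric_operator H -> self_adjoint X ->
  (* (C.2) *)
  (exists2 delta : R, 0 < delta &
    {in dom X, forall u, delta%:C * '[u, u] <= `|'[u, X u]|}) ->
  (* (C.3) *)
  core X D0 -> {subset D0 <= dom H} ->
  (exists a b : R, [/\ 0 <= a, 0 <= b &
    {in D0, forall u, `|H u| <= a%:C * `|X u| + b%:C * `|u|}]) ->
  (* (I) or (II) *)
  (exists2 d1 : R, 0 <= d1 &
    {in D0, forall u,
      `|'[H u, X u] + '[X u, H u]| <= d1%:C * `|'[u, X u]|}) \/
  (exists2 d2 : R, 0 < d2 &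
    {in D0, forall u,
      d2%:C * `|'[u, X u]| <= `|'[H u, X u] + '[X u, H u]|}) ->
  essentially_self_adjoint_on H D0.
Proof.
move=> [_ sH] saX [delta delta0 Xbelow] [subX coreX] subH.
move=> [a [b [a0 b0 Hbd]]] cond.
have sX : symmetric_operator X by case: saX => dX gX; split => //; rewrite -gX.
have Xb : {in dom X, forall u, delta * rnorm u ^+ 2 <= rnorm '[u, X u]}.
  by move=> u /Xbelow; rewrite inner_self rnormE -rmorphM /= lecR.
have qE u : u \in D0 -> '[u, X u] = (complex.Re '[u, X u])%:C.
  move=> /subX Du; have := symmetric_inner_real sX Du.
  rewrite (inner_conj u); case: '[X u, u] => x y /= ->.
  by apply/eqP; rewrite eq_complex /= oppr0 !eqxx.
have [mu [c [c0 key]]] : exists mu c : R, 0 < c /\ {in D0, forall u,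
    c * rnorm '[u, X u] <=
    `|complex.Re '[H u, X u] - mu * complex.Re '[u, X u]|}.
  case: cond => [[d d0 Hd]|[d d0 Hd]].
  - exists (d / 2 + 1), 1; split=> // u Du; have := Hd u Du.
    rewrite !rnormE -rmorphM lecR anticommutator_rnorm /= => h.
    have := ler_distD (complex.Re '[H u, X u]) 0
      ((d / 2 + 1) * complex.Re '[u, X u]).
    move: h; rewrite (qE u Du) rnormC /= !sub0r !normrN normrM.
    have -> : `|d / 2 + 1| = d / 2 + 1.
      by rewrite ger0_norm // addr_ge0 ?divr_ge0.
    lra.
  - exists 0, (d / 2); split=> [|u Du]; first by rewrite divr_gt0.
    have := Hd u Du.
    rewrite !rnormE -rmorphM lecR anticommutator_rnorm /= mul0r subr0; lra.
exists subH; set A := Defs.restrict subH.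
have sA : symmetric_operator A.
  split; first by apply: core_dense coreX; case: saX.
  move=> [u w] [/= Du ->] v Dv /=.
  by apply: (sH (u, H u)) => /=; [split => //=; exact: (subH)|exact: (subH)].
have dr z : complex.Re z = mu -> dense (shifted_range A z).
  move=> zE.
  apply: (@dense_range_of_form_bound R V A X z
    (a + b + rnorm z) (c * delta) subX).
  - exact: coreX.
  - exact: self_adjoint_onto delta0 Xb.
  - by rewrite !addr_ge0 ?rnorm_ge0.
  - by rewrite mulr_gt0.
  - move=> u Du; have := Hbd u Du; rewrite !rnormE -!rmorphM -rmorphD /= lecR => h.
    have := ler_rnormD (H u) (- (z *: u)); rewrite rnormN rnormZ.
    have := mulr_ge0 b0 (rnorm_ge0 (X u)).
    have := mulr_ge0 a0 (rnorm_ge0 u).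
    have := mulr_ge0 (rnorm_ge0 z) (rnorm_ge0 (X u)).
    move: h; rewrite /=; lra.
  - move=> u Du; rewrite (le_trans _ (ler_Re_rnorm _)) //.
    rewrite innerBl innerZl.
    have -> : complex.Re ('[A u, X u] - z * '[u, X u]) =
        complex.Re '[H u, X u] - mu * complex.Re '[u, X u].
      rewrite (qE u Du) -zE; case: (z) => x y /=.
      by case: '[_, _] => p q /=; rewrite mulr0 subr0.
    rewrite (le_trans _ (key u Du)) // -mulrA ler_wpM2l ?(ltW c0) //.
    by apply: Xb; exact: (subX).
apply: (@essentially_self_adjoint_of_dense_range _ _ A (Complex mu 1)) => //=.
- exact: dr.
- exact: dr.
Qed.
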